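(* (Vanishing.) Let $\mathbf C$ be a cancellative atomic Markov category with conditionals. Every morphism $g:X\otimes I\to Y\otimes I$ is traceable (with respect to $I$), and $\mathbf{tr}^I(g)=g$ (up to the unit isomorphisms $X\otimes I\cong X$, $Y\otimes I\cong Y$).
   Context: A Markov category is a symmetric monoidal category $(\mathbf C,\otimes,I)$ in which every object $X$ carries a commutative comonoid $\Delta_X:X\to X\otimes X$, $\mathrm{del}_X:X\to I$, compatible with $\otimes$, and every $f:X\to Y$ satisfies $\mathrm{del}_Y\circ f=\mathrm{del}_X$. Naturality of $\Delta$ is not assumed. Coherence isomorphisms are suppressed. $\mathbf C$ has conditionals if for every $f:A\to X\otimes Y$ there is $f|_X:X\otimes A\to Y$ with $f=(\mathrm{id}_X\otimes f|_X)\circ(\Delta_X\otimes\mathrm{id}_A)\circ\big(((\mathrm{id}_X\otimes\mathrm{del}_Y)\circ f)\otimes\mathrm{id}_A\big)\circ\Delta_A$. For $p:A\to X$ and $f_1,f_2:W\otimes X\to Y$, write $f_1=_pf_2$ if $(f_1\otimes\mathrm{id}_X)\circ(\mathrm{id}_W\otimes(\Delta_X\circ p))=(f_2\otimes\mathrm{id}_X)\circ(\mathrm{id}_W\otimes(\Delta_X\circ p))$. For $p:A\to X$, $q:B\to X$ write $p\ll q$ if for all $W,Y$ and $f_1,f_2:W\otimes X\to Y$, $f_1=_qf_2$ implies $f_1=_pf_2$. $p:A\to X$ is atomic if $\Delta_X\circ p\ll p\otimes p$; $\mathbf C$ is atomic if all its morphisms are. An object $W$ is cancellable if $\mathrm{del}_W\otimes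 f_1=\mathrm{del}_W\otimes f_2$ implies $f_1=f_2$ for all parallel $f_1,f_2$; $\mathbf C$ is cancellative if all objects are cancellable. A morphism $f:X\otimes W'\to Y\otimes W$ is non-signalling (from $W'$ to $W$) if there is $f_s:X\to W$ with $(\mathrm{del}_Y\otimes\mathrm{id}_W)\circ f=f_s\otimes\mathrm{del}_{W'}$. A disintegration of $f$ is a pair $f_s:X\to W$, $f_p:X\otimes W\otimes W'\to Y$ with $f=(f_p\otimes\mathrm{id}_W)\circ(\mathrm{id}_{X\otimes W}\otimes\mathrm{swap}_{W,W'})\circ(s\otimes\mathrm{id}_{W'})$, where $s=(\mathrm{id}_X\otimes(\Delta_W\circ f_s))\circ\Delta_X:X\to X\otimes W\otimes W$. In a Markov category with conditionals, $f$ is non-signalling iff it has a disintegration. $f:X\otimes W\to Y\otimes W$ is called traceable (with respect to $W$) if it is non-signalling from the input $W$ to the output $W$; its causal trace is $\mathbf{tr}^W(f)=f_p\circ s:X\to Y$ for any disintegration (with $W'=W$); under the stated assumptions on $\mathbf C$ this does not depend on the choice of disintegration. *)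

(* Defs.v *)
Set Implicit Arguments.
Unset Strict Implicit.
Unset Printing Implicit Defensive.

Declare Scope markov_scope.
Open Scope markov_scope.

Reserved Notation "g ∘ f" (at level 40, left associativity).
Reserved Notation "X ⊗ Y" (at level 38, left associativity).
Reserved Notation "f ⊠ g" (at level 38, left associativity).

Record category := Category {
  ob :> Type;
  hom : ob -> ob -> Type;
  idm : forall X, hom X X;
  comp : forall {X Y Z}, hom Y Z -> hom X Y -> hom X Z
    where "g ∘ f" := (comp g f);
  comp_idl : forall X Y (f : hom X Y), idm Y ∘ f = f;
  comp_idr : forall X Y (f : hom X Y), f ∘ idm X = f;
  comp_assoc : forall X Y Z T (f : hom X Y) (g : hom Y Z) (h : hom Z T),
    h ∘ (g ∘ f) = (h ∘ g) ∘ f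
}.

Arguments idm {c} X.
Arguments comp {c X Y Z} g f.
Notation "g ∘ f" := (comp g f) : markov_scope.

(* [X ⊗ Y] is the tensor of objects, [f ⊠ g] the tensor of morphisms.
   Nothing is assumed strict: [alpha], [lambda], [rho] are the associator and
   the left and right unitors, with inverses [alphaV], [lambdaV], [rhoV]. *)
Record monoidal_category := MonoidalCategory {
  mcat :> category;
  tensor : mcat -> mcat -> mcat
    where "X ⊗ Y" := (tensor X Y);
  munit : mcat;
  tensor_hom : forall {X X' Y Y' : mcat},
    hom X X' -> hom Y Y' -> hom (X ⊗ Y) (X' ⊗ Y')
    where "f ⊠ g" := (tensor_hom f g);
  alpha : forall X Y Z, hom ((X ⊗ Y) ⊗ Z) (X ⊗ (Y ⊗ Z));
  alphaV : forall X Y Z, hom (X ⊗ (Y ⊗ Z)) ((X ⊗ Y) ⊗ Z);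
  lambda : forall X, hom (munit ⊗ X) X;
  lambdaV : forall X, hom X (munit ⊗ X);
  rho : forall X, hom (X ⊗ munit) X;
  rhoV : forall X, hom X (X ⊗ munit);
  tensor_id : forall X Y : mcat, idm X ⊠ idm Y = idm (X ⊗ Y);
  tensor_comp : forall (X X' X'' Y Y' Y'' : mcat)
      (f : hom X X') (f' : hom X' X'') (g : hom Y Y') (g' : hom Y' Y''),
    (f' ∘ f) ⊠ (g' ∘ g) = (f' ⊠ g') ∘ (f ⊠ g);
  alphaK : forall X Y Z, alphaV X Y Z ∘ alpha X Y Z = idm ((X ⊗ Y) ⊗ Z);
  alphaVK : forall X Y Z, alpha X Y Z ∘ alphaV X Y Z = idm (X ⊗ (Y ⊗ Z));
  lambdaK : forall X, lambdaV X ∘ lambda X = idm (munit ⊗ X);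
  lambdaVK : forall X, lambda X ∘ lambdaV X = idm X;
  rhoK : forall X, rhoV X ∘ rho X = idm (X ⊗ munit);
  rhoVK : forall X, rho X ∘ rhoV X = idm X;
  alpha_nat : forall (X X' Y Y' Z Z' : mcat)
      (f : hom X X') (g : hom Y Y') (h : hom Z Z'),
    alpha X' Y' Z' ∘ ((f ⊠ g) ⊠ h) = (f ⊠ (g ⊠ h)) ∘ alpha X Y Z;
  lambda_nat : forall (X Y : mcat) (f : hom X Y),
    lambda Y ∘ (idm munit ⊠ f) = f ∘ lambda X;
  rho_nat : forall (X Y : mcat) (f : hom X Y),
    rho Y ∘ (f ⊠ idm munit) = f ∘ rho X;
  pentagon : forall X Y Z T,
    alpha X Y (Z ⊗ T) ∘ alpha (X ⊗ Y) Z T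
    = (idm X ⊠ alpha Y Z T) ∘ alpha X (Y ⊗ Z) T ∘ (alpha X Y Z ⊠ idm T);
  triangle : forall X Y,
    (idm X ⊠ lambda Y) ∘ alpha X munit Y = rho X ⊠ idm Y
}.

Arguments tensor {m} X Y.
Arguments tensor_hom {m X X' Y Y'} f g.
Arguments munit {m}.
Arguments alpha {m} X Y Z.
Arguments alphaV {m} X Y Z.
Arguments lambda {m} X.
Arguments lambdaV {m} X.
Arguments rho {m} X.
Arguments rhoV {m} X.
Notation "X ⊗ Y" := (tensor X Y) : markov_scope.
Notation "f ⊠ g" := (tensor_hom f g) : markov_scope.

Record symmetric_monoidal_category := SymmetricMonoidalCategory {
  smcat :> monoidal_category;
  swap : forall X Y : smcat, hom (X ⊗ Y) (Y ⊗ X);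
  swap_nat : forall (X X' Y Y' : smcat) (f : hom X X') (g : hom Y Y'),
    swap X' Y' ∘ (f ⊠ g) = (g ⊠ f) ∘ swap X Y;
  swapK : forall X Y, swap Y X ∘ swap X Y = idm (X ⊗ Y);
  hexagon : forall X Y Z,
    alpha Y Z X ∘ swap X (Y ⊗ Z) ∘ alpha X Y Z
    = (idm Y ⊠ swap X Z) ∘ alpha Y X Z ∘ (swap X Y ⊠ idm Z)
}.

Arguments swap {s} X Y.

(* The middle-four interchange, in terms of which [copy] on a tensor product
   is expressed. *)
Definition interchange (C : symmetric_monoidal_category) (X Y Z T : C) :
    hom ((X ⊗ Y) ⊗ (Z ⊗ T)) ((X ⊗ Z) ⊗ (Y ⊗ T)) :=
  alphaV X Z (Y ⊗ T)
  ∘ (idm X ⊠ (alpha Z Y T ∘ (swap Y Z ⊠ idm T) ∘ alphaV Y Z T))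
  ∘ alpha X Y (Z ⊗ T).

(* Compatibility of the comonoids with the monoidal structure is required for
   the unit as well ([copy_unit], [del_unit]); these two laws follow from the
   remaining ones. *)
Record markov_category := MarkovCategory {
  base :> symmetric_monoidal_category;
  copy : forall X : base, hom X (X ⊗ X);
  del : forall X : base, hom X munit;
  copy_assoc : forall X,
    alpha X X X ∘ (copy X ⊠ idm X) ∘ copy X = (idm X ⊠ copy X) ∘ copy X;
  copy_dell : forall X, lambda X ∘ (del X ⊠ idm X) ∘ copy X = idm X;
  copy_delr : forall X, rho X ∘ (idm X ⊠ del X) ∘ copy X = idm X;
  copy_comm : forall X, swap X X ∘ copy X = copy X;
  copy_tensor : forall X Y,
    copy (X ⊗ Y) = interchange X X Y Y ∘ (copy X ⊠ copy Y);
  del_tensor : forall X Y, del (X ⊗ Y) = lambda munit ∘ (del X ⊠ del Y);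
  copy_unit : copy munit = lambdaV munit;
  del_unit : del munit = idm munit;
  del_nat : forall (X Y : base) (f : hom X Y), del Y ∘ f = del X
}.

Arguments copy {m} X.
Arguments del {m} X.

Definition is_conditional (C : markov_category) (A X Y : C)
    (f : hom A (X ⊗ Y)) (c : hom (X ⊗ A) Y) : Prop :=
  f = (idm X ⊠ c) ∘ alpha X X A ∘ (copy X ⊠ idm A)
      ∘ ((rho X ∘ (idm X ⊠ del Y) ∘ f) ⊠ idm A) ∘ copy A.

Definition has_conditionals (C : markov_category) : Prop :=
  forall (A X Y : C) (f : hom A (X ⊗ Y)), exists c, is_conditional f c.

(* [as_eq p f1 f2] is the almost sure equality [f1 =_p f2] and [abs_cont p q]
   the absolute continuity [p << q]. *)
Definition as_eq (C : markov_category) (A X : C) (p : hom A X)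
    (W Y : C) (f1 f2 : hom (W ⊗ X) Y) : Prop :=
  (f1 ⊠ idm X) ∘ alphaV W X X ∘ (idm W ⊠ (copy X ∘ p))
  = (f2 ⊠ idm X) ∘ alphaV W X X ∘ (idm W ⊠ (copy X ∘ p)).

Definition abs_cont (C : markov_category) (A B X : C)
    (p : hom A X) (q : hom B X) : Prop :=
  forall (W Y : C) (f1 f2 : hom (W ⊗ X) Y), as_eq q f1 f2 -> as_eq p f1 f2.

Definition atomic (C : markov_category) (A X : C) (p : hom A X) : Prop :=
  abs_cont (copy X ∘ p) (p ⊠ p).

Definition is_atomic (C : markov_category) : Prop :=
  forall (A X : C) (p : hom A X), atomic p.

Definition cancellable (C : markov_category) (W : C) : Prop :=
  forall (A B : C) (f1 f2 : hom A B), del W ⊠ f1 = del W ⊠ f2 -> f1 = f2.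

Definition is_cancellative (C : markov_category) : Prop :=
  forall W : C, cancellable W.

Definition non_signalling (C : markov_category) (X Y W W' : C)
    (f : hom (X ⊗ W') (Y ⊗ W)) : Prop :=
  exists fs : hom X W, lambda W ∘ (del Y ⊠ idm W) ∘ f = rho W ∘ (fs ⊠ del W').

Definition state_copy (C : markov_category) (X W : C) (fs : hom X W) :
    hom X ((X ⊗ W) ⊗ W) :=
  alphaV X W W ∘ (idm X ⊠ (copy W ∘ fs)) ∘ copy X.

Definition disintegration (C : markov_category) (X Y W W' : C)
    (f : hom (X ⊗ W') (Y ⊗ W))
    (fs : hom X W) (fp : hom ((X ⊗ W) ⊗ W') Y) : Prop :=
  f = (fp ⊠ idm W)
      ∘ (alphaV (X ⊗ W) W' W ∘ (idm (X ⊗ W) ⊠ swap W W') ∘ alpha (X ⊗ W) W W')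
      ∘ (state_copy fs ⊠ idm W').

Definition traceable (C : markov_category) (X Y W : C)
    (f : hom (X ⊗ W) (Y ⊗ W)) : Prop :=
  non_signalling f.

(* [t] is the causal trace of [f]: a disintegration of [f] exists, and every
   disintegration of [f] yields [t].  So independence of the choice of
   disintegration is part of the claim that [f] has causal trace [t]. *)
Definition is_causal_trace (C : markov_category) (X Y W : C)
    (f : hom (X ⊗ W) (Y ⊗ W)) (t : hom X Y) : Prop :=
  (exists fs fp, disintegration f fs fp) /\
  (forall fs fp, disintegration f fs fp -> fp ∘ state_copy fs = t).

(* Main.v *)
Require Import Defs.

(** The unit object is terminal, hence so is [munit ⊗ munit], and the swap
    inside a disintegration with respect to [munit] is an identity.  Such a
    disintegration of [g] therefore reads
    [g = (fp ∘ state_copy fs) ⊠ idm munit], and the right unitor recovers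
    [fp ∘ state_copy fs] from [g].  Conversely, as [fs] can only be [del X],
    [state_copy fs] is a section of the unitors
    [(X ⊗ munit) ⊗ munit -> X], so that [g] itself, precomposed with these
    unitors, serves as [fp]. *)

Lemma hom_munit_eq (C : markov_category) (A : C) (f f' : hom A munit) : f = f'.
Proof.
  rewrite <- (comp_idl f), <- (comp_idl f'), <- del_unit.
  now rewrite !del_nat.
Qed.

Lemma rho_inj (M : monoidal_category) (A X : M) (f f' : hom A (X ⊗ munit)) :
  rho X ∘ f = rho X ∘ f' -> f = f'.
Proof.
  intro H.
  now rewrite <- (comp_idl f), <- (comp_idl f'), <- rhoK, <- !comp_assoc, H.
Qed.

Lemma tensor_munit_rho (M : monoidal_category) (X Y : M)
    (g : hom (X ⊗ munit) (Y ⊗ munit)) :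
  (rho Y ∘ g ∘ rhoV X) ⊠ idm munit = g.
Proof.
  apply rho_inj.
  now rewrite rho_nat, <- comp_assoc, rhoK, comp_idr.
Qed.

Lemma rho_tensor_munit (M : monoidal_category) (X Y : M) (h : hom X Y) :
  rho Y ∘ (h ⊠ idm munit) ∘ rhoV X = h.
Proof. now rewrite rho_nat, <- comp_assoc, rhoVK, comp_idr. Qed.

(** After cancelling [rho X], this is naturality of [rho] at the morphism [rho X] itself. *)
Lemma rho_tensor_unit (M : monoidal_category) (X : M) :
  rho (X ⊗ munit) = rho X ⊠ idm munit.
Proof. apply rho_inj. now rewrite rho_nat. Qed.

Lemma swap_munit (C : markov_category) :
  swap munit munit = idm ((munit : C) ⊗ munit).
Proof. apply rho_inj, hom_munit_eq. Qed.

Lemma rho_state_copy (C : markov_category) (X : C) (fs : hom X munit) :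
  rho X ∘ rho (X ⊗ munit) ∘ state_copy fs = idm X.
Proof.
  unfold state_copy.
  (* The triangle law produces an [alpha] that cancels the [alphaV] of [state_copy]. *)
  rewrite rho_tensor_unit, <- triangle, !comp_assoc.
  rewrite <- (comp_assoc (alphaV X munit munit) (alpha X munit munit)).
  rewrite alphaVK, comp_idr.
  rewrite <- (comp_assoc (idm X ⊠ (copy munit ∘ fs))), <- tensor_comp, comp_idl.
  (* Terminality of [munit] leaves only the right counit law of [copy X]. *)
  rewrite (hom_munit_eq _ _ (lambda munit ∘ (copy munit ∘ fs)) (del X)).
  apply copy_delr.
Qed.

Lemma disintegration_munit (C : markov_category) (X Y : C)
    (g : hom (X ⊗ munit) (Y ⊗ munit))
    (fs : hom X munit) (fp : hom ((X ⊗ munit) ⊗ munit) Y) :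
  disintegration g fs fp <-> g = (fp ∘ state_copy fs) ⊠ idm munit.
Proof.
  unfold disintegration.
  rewrite swap_munit, tensor_id, comp_idr, alphaK, comp_idr, <- tensor_comp.
  now rewrite comp_idl.
Qed.

Theorem proposition21 (C : markov_category)
    (hcanc : is_cancellative C) (hatom : is_atomic C)
    (hcond : has_conditionals C)
    (X Y : C) (g : hom (X ⊗ munit) (Y ⊗ munit)) :
  traceable g /\ is_causal_trace g (rho Y ∘ g ∘ rhoV X).
Proof.
  split; [| split].
  (* Both sides of the non-signalling equation end in the terminal [munit]. *)
  - exists (del X). apply hom_munit_eq.
  - exists (del X), (rho Y ∘ g ∘ rhoV X ∘ (rho X ∘ rho (X ⊗ munit))).
    apply disintegration_munit.
    now rewrite <- (comp_assoc (state_copy _)), rho_state_copy, comp_idr,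
      tensor_munit_rho.
  - intros fs fp ->%disintegration_munit.
    now rewrite rho_tensor_munit.
Qed.
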